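(* Up to permutation of the variables, the artinian monomial ideals of $\mathbb{C}[x,y,z]$ generated by five (distinct) monomials of degree $4$ that fail the WLP in degree $3$ are exactly the following two: $$I_1=(x^4,y^4,z^4,x^3z,x^3y),\qquad I_2=(x^4,y^4,z^4,x^2y^2,xyz^2).$$
   Context: For an artinian homogeneous ideal $I$ in $R=\mathbb{C}[x,y,z]$, put $A=R/I=\bigoplus_jA_j$. $I$ fails the WLP (Weak Lefschetz Property) in degree $j$ if for every linear form $L$ the multiplication map $\times L:A_j\to A_{j+1}$ does not have maximal rank (i.e. is neither injective nor surjective). A monomial ideal generated in degree $4$ is artinian if and only if it contains $x^4,y^4,z^4$. *)

(* Defs.v *)
From HB Require Import structures.
From mathcomp Require Import all_boot all_order all_fingroup all_algebra.
From mathcomp Require Import boolp classical_sets functions reals complex mpoly.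

Set Implicit Arguments.
Unset Strict Implicit.
Unset Printing Implicit Defensive.

Import GRing.Theory.
Local Open Scope ring_scope.
Local Open Scope quotient_scope.
Local Open Scope classical_set_scope.

(* Membership is made boolean (classically) so that ideals fit the library's
   [idealr] interface and its quotient rings {ideal_quot I}. *)
Definition ideal_gen (A : comNzRingType) (G : seq A) : {pred A} :=
  fun f => `[< exists c : 'I_(size G) -> A, f = \sum_i c i * G`_i >].

Lemma ideal_gen_closed (n : nat) (K : comNzRingType) (G : seq {mpoly K[n]}) :
  all (fun g => g.@[fun=> 0] == 0) G -> idealr_closed (ideal_gen G).
Proof.
move=> G0; split.
- apply/asboolP; exists (fun=> 0).
  by rewrite big1 // => i _; rewrite mul0r.
- apply/asboolP => -[c /(congr1 (meval (fun=> 0)))].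
  rewrite meval1 raddf_sum big1 /= => [/eqP|i _]; first by rewrite oner_eq0.
  by rewrite mevalM (eqP (all_nthP 0 G0 i (ltn_ord i))) mulr0.
- move=> a _ _ /asboolP[c ->] /asboolP[d ->]; apply/asboolP.
  exists (fun i => a * c i + d i); rewrite mulr_sumr -big_split /=.
  by apply: eq_bigr => i _; rewrite mulrDl mulrA.
Qed.

(* Descending chain condition on ideals: the ideals of a commutative ring A
   are the submodules of the regular module A^o. *)
Definition artinian_ring (A : comNzRingType) : Prop :=
  forall J : nat -> {pred A},
    (forall n, @GRing.submod_closed A A^o (J n)) ->
    (forall n, {subset J n.+1 <= J n}) ->
  exists N, forall n, (N <= n)%N -> J n =i J N.

Definition artinian_ideal (A : comNzRingType) (I : idealr A) : Prop :=
  artinian_ring {ideal_quot I}.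

Section WeakLefschetz.
Variables (n : nat) (K : comNzRingType) (I : idealr {mpoly K[n]}).

Definition graded_piece (j : nat) : set {ideal_quot I} :=
  \pi_{ideal_quot I} @` [set f | f \is j.-homog].

Definition mul_form (L : {mpoly K[n]}) (a : {ideal_quot I}) : {ideal_quot I} :=
  \pi_{ideal_quot I} L * a.

Definition fails_WLP (j : nat) : Prop :=
  forall L : {mpoly K[n]}, L \is 1.-homog ->
    ~ set_inj (graded_piece j) (mul_form L) /\
    ~ set_surj (graded_piece j) (graded_piece j.+1) (mul_form L).

Definition generated_by_monomials (k d : nat) : Prop :=
  exists s : seq 'X_{1..n},
    [/\ uniq s, size s = k, {in s, forall m, mdeg m = d} &
        I =i ideal_gen [seq 'X_[m] | m <- s]].

Definition eq_up_to_perm (J : idealr {mpoly K[n]}) : Prop :=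
  exists s : 'S_n, [set` I] = msym s @` [set` J].

End WeakLefschetz.

Section TheTwoIdeals.
Variable K : comNzRingType.

Let x : {mpoly K[3]} := 'X_(@Ordinal 3 0 isT).
Let y : {mpoly K[3]} := 'X_(@Ordinal 3 1 isT).
Let z : {mpoly K[3]} := 'X_(@Ordinal 3 2 isT).

Definition I1 : {pred {mpoly K[3]}} :=
  ideal_gen [:: x ^+ 4; y ^+ 4; z ^+ 4; x ^+ 3 * z; x ^+ 3 * y].

Definition I2 : {pred {mpoly K[3]}} :=
  ideal_gen [:: x ^+ 4; y ^+ 4; z ^+ 4; x ^+ 2 * y ^+ 2; x * y * z ^+ 2].

Lemma I1_closed : idealr_closed I1.
Proof.
by apply: ideal_gen_closed;
   rewrite /= !(mevalM, mevalXU, rmorphXn, expr0n, mulr0, mul0r, eqxx).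
Qed.

Lemma I2_closed : idealr_closed I2.
Proof.
by apply: ideal_gen_closed;
   rewrite /= !(mevalM, mevalXU, rmorphXn, expr0n, mulr0, mul0r, eqxx).
Qed.

HB.instance Definition _ := isIdealr.Build {mpoly K[3]} I1 I1_closed.
HB.instance Definition _ := isIdealr.Build {mpoly K[3]} I2 I2_closed.

End TheTwoIdeals.

(* Main.v *)
(** For five quartic monomials, A_3 and A_4 both have dimension 10, so the WLP fails in
    degree 3 iff every linear form L kills some nonzero cubic modulo I. For the first ideal
    x^3 is such a cubic for every L; for the second it comes from factoring
    (a^2 x^2 - b^2 y^2)^2 + 4 a b c^2 x y z^2 - c^4 z^4, which has ax + by + cz as a factor.
    Conversely, take L = x + y + z. If L f is a combination of x^4, y^4, z^4, m, m', then this
    combination vanishes on the line L = 0. Functionals on the restrictions of quartics to that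
    line which annihilate x^4, y^4, z^4 form a 2-dimensional space; the pairs (m, m') whose two
    images are proportional are exactly the permutations of the two exceptional pairs.
    Quotients containing powers of all variables are finite-dimensional, hence artinian; in
    an artinian quotient some X_i^N is a multiple of X_i^(N+1), which puts a power of X_i among
    the generators. *)
Require Import Defs.
From HB Require Import structures.
From mathcomp Require Import all_boot all_order all_fingroup all_algebra.
From mathcomp Require Import boolp classical_sets functions reals complex mpoly.
From mathcomp Require Import zify ring.
Set Implicit Arguments.
Unset Strict Implicit.
Unset Printing Implicit Defensive.

Import Num.Theory GRing.Theory.
Local Open Scope ring_scope.
Local Open Scope quotient_scope.

Local Notation "m # s" := [multinom m (s i) | i < _]
  (at level 40, left associativity).

(** * Finitely generated ideals *)

Section IdealGen.
Variable A : comNzRingType.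
Implicit Types (G H : seq A) (f g : A).

Lemma ideal_gen0 G : 0 \in ideal_gen G.
Proof. by apply/asboolP; exists (fun=> 0); rewrite big1 // => i _; rewrite mul0r. Qed.

Lemma ideal_genD G f g :
  f \in ideal_gen G -> g \in ideal_gen G -> f + g \in ideal_gen G.
Proof.
move=> /asboolP[c ->] /asboolP[d ->]; apply/asboolP.
exists (fun i => c i + d i); rewrite -big_split /=.
by apply: eq_bigr => i _; rewrite mulrDl.
Qed.

Lemma ideal_genM G f g : g \in ideal_gen G -> f * g \in ideal_gen G.
Proof.
move=> /asboolP[c ->]; apply/asboolP; exists (fun i => f * c i).
by rewrite mulr_sumr; apply: eq_bigr => i _; rewrite mulrA.
Qed.

Lemma mem_ideal_gen G : {subset G <= ideal_gen G}.
Proof.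
move=> g gG; apply/asboolP; have lt_g : (index g G < size G)%N by rewrite index_mem.
exists (fun i => (i == Ordinal lt_g)%:R).
rewrite (bigD1 (Ordinal lt_g)) //= eqxx mul1r nth_index // big1 ?addr0 // => i.
by move=> /negPf->; rewrite mul0r.
Qed.

End IdealGen.

(** * Monomial ideals: membership, low degrees, permutation of the variables *)

Section MonomialIdeals.
Variables (n : nat) (K : comNzRingType).
Implicit Types (f : {mpoly K[n]}) (s t : seq 'X_{1..n}).

Definition monomial_ideal s : {pred {mpoly K[n]}} :=
  ideal_gen [seq 'X_[m] | m <- s].

(** Every monomial of a combination of generators is a multiple of one of them; conversely [f] is
    the sum of its terms, each a multiple of a generator. *)
Lemma monomial_idealP s f :
  reflect {in msupp f, forall m, has (fun m' => (m' <= m)%MM) s}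
          (f \in monomial_ideal s).
Proof.
apply: (iffP idP) => [/asboolP[c ->] m|fs].
  move=> /msupp_sum_le /flatten_mapP[i _]; have := ltn_ord i.
  rewrite {2}size_map => lt_i; rewrite (nth_map 0%MM) //.
  rewrite (perm_mem (msuppMX _ _)) => /mapP[m' _ ->].
  apply/hasP; exists (nth 0%MM s i); first exact: mem_nth.
  by apply/mnm_lepP => k; rewrite mnmDE leq_addr.
rewrite [f]mpolyE big_seq; elim/big_ind: _ => [|g h|m m_f].
- exact: ideal_gen0.
- exact: ideal_genD.
have /hasP[m' m's lem] := fs m m_f.
rewrite -(submK lem) mpolyXD -mul_mpolyC mulrA.
by apply/ideal_genM/mem_ideal_gen/map_f.
Qed.

Lemma eq_monomial_ideal s t : s =i t -> monomial_ideal s =i monomial_ideal t.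
Proof.
by move=> st f; apply/monomial_idealP/monomial_idealP => h m /h;
   rewrite (eq_has_r st).
Qed.

Lemma mnm_le_mdeg_eq (m m' : 'X_{1..n}) :
  (m <= m')%MM -> (mdeg m' <= mdeg m)%N -> m = m'.
Proof.
move=> le_m; rewrite -(submK le_m) mdegD -[leqRHS]add0n leq_add2r leqn0 mdeg_eq0.
by move=> /eqP->; rewrite add0m.
Qed.

(** A generator that divides a monomial of the same degree is equal to it. *)
Lemma homog_monomial_ideal d s f :
    {in s, forall m, mdeg m = d} -> f \is d.-homog ->
  f \in monomial_ideal s = all (mem s) (msupp f).
Proof.
move=> sd /dhomogP fd; apply/monomial_idealP/allP => fs m m_f.
  have /hasP[m' m's le_m] := fs m m_f.
  by rewrite -(mnm_le_mdeg_eq le_m) ?(fd m) ?(sd m').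
by apply/hasP; exists m; [exact: fs|exact: lepm_refl].
Qed.

(** A monomial of degree below [d] has no divisor of degree [d]. Hence the quotient agrees with the
    polynomial ring in the degrees below [d]. *)
Lemma monomial_ideal_low d j s f :
    {in s, forall m, mdeg m = d} -> f \is j.-homog -> (j < d)%N ->
  f \in monomial_ideal s -> f = 0.
Proof.
move=> sd /dhomogP fj lt_jd /monomial_idealP fs; apply: msuppnil0.
case def_f: (msupp f) (fs) (fj) => [//|m r] /(_ m (mem_head _ _))/hasP[m' m's].
move=> /mnm_lepP le_m /(_ m (mem_head _ _)) /= dm; move: lt_jd.
rewrite -(sd m' m's) -[j]dm ltnNge !mdegE.
by rewrite (leq_sum _ _) // => i _; exact: le_m.
Qed.

(** By [mcoeff_sym], [m] occurs in [msym sg f] iff [m#sg] occurs in [f], and permuting the exponents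
    preserves divisibility. *)
Lemma msym_monomial_ideal (sg : 'S_n) s f :
  (msym sg f \in monomial_ideal s) =
  (f \in monomial_ideal [seq m#sg | m : 'X_{1..n} <- s]).
Proof.
have le_perm (m m' : 'X_{1..n}) : (m#sg <= m'#sg)%MM = (m <= m')%MM.
  apply/mnm_lepP/mnm_lepP => le_m i; last by rewrite !mnmE.
  by have := le_m (sg^-1%g i); rewrite !mnmE permKV.
apply/monomial_idealP/monomial_idealP => fs m.
  rewrite -[m](mpermK sg) mcoeff_msupp -mcoeff_sym -mcoeff_msupp => /fs.
  rewrite has_map; apply: etrans; apply: eq_has => m' /=.
  by rewrite le_perm.
rewrite mcoeff_msupp mcoeff_sym -mcoeff_msupp => /fs; rewrite has_map.
by apply: etrans; apply: eq_has => m' /=; rewrite le_perm.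
Qed.

End MonomialIdeals.

Lemma homog_sum_monomials (n d : nat) (K : comNzRingType) (s : seq 'X_{1..n})
    (f : {mpoly K[n]}) :
    uniq s -> {in s, forall m, mdeg m = d} -> f \is d.-homog ->
  f \in monomial_ideal s -> f = \sum_(m <- s) f@_m *: 'X_[m].
Proof.
move=> s_uniq sd fd; rewrite (homog_monomial_ideal sd fd) => /allP fs.
apply/mpolyP => m; rewrite raddf_sum /=.
under eq_bigr do rewrite mcoeffZ mcoeffX.
have [m_s|m_s] := boolP (m \in s).
  rewrite (bigD1_seq m) //= eqxx mulr1 big1 ?addr0 // => m' /negPf->.
  by rewrite mulr0.
rewrite big_seq big1 => [|m' m'_s].
  by apply/eqP; rewrite mcoeff_eq0; apply: contra m_s; exact: fs.
by case: eqP m'_s m_s => [->->//|]; rewrite mulr0.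
Qed.

(** * Failure of the WLP in degree 3 as a kernel condition *)

Lemma pi_ideal_eq0 (A : comNzRingType) (I : idealr A) (f : A) :
  (\pi_{ideal_quot I} f == 0) = (f \in I).
Proof. by rewrite -(rmorph0 \pi_{ideal_quot I}) -Quotient.idealrBE subr0. Qed.

Section WLPFiveQuartics.
Variables (K : fieldType) (I : idealr {mpoly K[3]}) (s : seq 'X_{1..3}).
Hypotheses (s_uniq : uniq s) (s5 : size s = 5).
Hypotheses (s4 : {in s, forall m, mdeg m = 4}) (Is : I =i monomial_ideal s).

(* A_3 and A_4 both have dimension 10; equivalently, (g, c) |-> L g + sum_i c_i s_i is
   a linear map between spaces of dimension 10 + 5 and 15. *)
Lemma fails_WLP_kernel :
  fails_WLP I 3 <->
  forall L : {mpoly K[3]}, L \is 1.-homog ->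
    exists f : {mpoly K[3]}, [/\ f \is 3.-homog, f != 0 & L * f \in I].
Proof.
split=> failI L L1.
  have [ninj _] := failI L L1; apply: contrapT => noker; apply: ninj.
  move=> _ _ /set_mem[f f3 <-] /set_mem[g g3 <-] /eqP.
  rewrite /mul_form -!rmorphM -subr_eq0 -rmorphB pi_ideal_eq0 -mulrBr => LfgI.
  apply/eqP; rewrite -subr_eq0 -rmorphB /=; apply/eqP.
  have [->|fg0] := eqVneq (f - g) 0; first by rewrite rmorph0.
  by case: noker; exists (f - g); split=> //; exact: rpredB.
have [f [f3 f0 LfI]] := failI L L1; split=> [inj|surj].
  have /eqP : \pi_{ideal_quot I} f = \pi_{ideal_quot I} 0.
    apply: inj; rewrite ?inE; try by exists f.
      by exists 0; rewrite //= rpred0.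
    by rewrite /mul_form -!rmorphM mulr0 rmorph0; apply/eqP; rewrite pi_ideal_eq0.
  rewrite rmorph0 pi_ideal_eq0 Is => /(monomial_ideal_low s4 f3 isT) f_eq0.
  by rewrite f_eq0 eqxx in f0.
pose psi0 (p : dhomog 3 K 3 * 'rV[K]_5) : {mpoly K[3]} :=
  L * p.1 + \sum_(i < 5) p.2 0 i *: 'X_[nth 0%MM s i].
have psi_homog p : psi0 p \is 4.-homog.
  rewrite rpredD //; first by apply: (dhomogM L1); exact: dhomog_is_dhomog.
  apply: rpred_sum => i _; rewrite rpredZ // dhomogX; apply/eqP/s4.
  by rewrite mem_nth ?s5.
pose psi p : dhomog 3 K 4 := DHomog (psi_homog p).
have psi_lin : linear psi.
  move=> a p q; apply: val_inj; rewrite /= /psi0 /=.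
  rewrite mulrDr -scalerAr scalerDr addrACA; congr (_ + _).
  rewrite scaler_sumr -big_split /=; apply: eq_bigr => i _.
  by rewrite !mxE scalerDl scalerA.
pose psiL : {linear _ -> _} := HB.pack psi (GRing.isLinear.Build _ _ _ _ psi psi_lin).
pose h := linfun psiL.
(* Surjectivity of L onto A_4 writes a quartic [q'] as [L * g] plus a quartic of [I], and the latter
   is a scalar combination of the five generators. *)
have surj_h : limg h = fullv.
  apply/vspaceP => q; rewrite memvf; pose q' := mpoly_of_dhomog q.
  have [|_ [g g3 <-] Lgq] := surj (\pi_{ideal_quot I} q').
    by exists q' => //; exact: dhomog_is_dhomog.
  have qLgI : q' - L * g \in I.
    by rewrite -pi_ideal_eq0 rmorphB rmorphM /= -Lgq subrr.
  have qLg4 : q' - L * g \is 4.-homog.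
    by rewrite rpredB ?(dhomogM L1 g3) //; exact: dhomog_is_dhomog.
  pose c := \row_(i < 5) (q' - L * g)@_(nth 0%MM s i).
  apply/memv_imgP; exists (DHomog g3, c); rewrite ?memvf // lfunE /=.
  apply: val_inj; rewrite /= /psi0 /=.
  under eq_bigr do rewrite mxE.
  rewrite -[LHS](subrK (L * g)) addrC; congr (_ + _).
  rewrite Is in qLgI; rewrite {1}(homog_sum_monomials s_uniq s4 qLg4 qLgI).
  by rewrite (big_nth 0%MM) s5 big_mkord.
(* Rank-nullity: the source has dimension 10 + 5, the target 15. *)
have dim_h : (\dim (lker h) + 15 = 15)%N.
  have := limg_ker_dim h fullv; rewrite capfv surj_h !dimvf.
  by [].
have ker0 : lker h = 0%VS by apply/eqP; rewrite -dimv_eq0; lia.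
(* Paired with the negated coefficients of [L * f], the cubic [f] gives a nonzero element of the
   trivial kernel. *)
pose c := \row_(i < 5) - (L * f)@_(nth 0%MM s i).
have : (DHomog f3, c) \in lker h.
  rewrite memv_ker lfunE /=; apply/eqP/val_inj; rewrite /= /psi0 /=.
  rewrite Is in LfI; have Lf4 := dhomogM L1 f3.
  rewrite {1}(homog_sum_monomials s_uniq s4 Lf4 LfI).
  rewrite (big_nth 0%MM) s5 big_mkord -big_split big1 // => i _.
  by rewrite mxE scaleNr /= subrr.
rewrite ker0 memv0 => /eqP[] f_eq0 _.
by rewrite f_eq0 eqxx in f0.
Qed.
End WLPFiveQuartics.

(** * Exponent triples and functionals on the line x + y + z = 0 *)

Definition mon3 (e : seq nat) : 'X_{1..3} := [multinom nth 0 e i | i < 3].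

Definition pure4 : seq (seq nat) := [:: [:: 4; 0; 0]; [:: 0; 4; 0]; [:: 0; 0; 4]].

Definition mixed4 : seq (seq nat) :=
  [:: [:: 3; 1; 0]; [:: 3; 0; 1]; [:: 1; 3; 0]; [:: 0; 3; 1]; [:: 1; 0; 3]; [:: 0; 1; 3];
      [:: 2; 2; 0]; [:: 2; 0; 2]; [:: 0; 2; 2]; [:: 2; 1; 1]; [:: 1; 2; 1]; [:: 1; 1; 2]].

Definition mon3_val (e : seq nat) (p : seq int) : int :=
  p`_0 ^+ nth 0 e 0 * p`_1 ^+ nth 0 e 1 * p`_2 ^+ nth 0 e 2.

(** A weighted sum of point evaluations. Exponents, points and weights are plain lists of numbers,
    so that the finite checks can be run by [vm_compute] and the values cast into the field
    afterwards. *)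
Definition line_form (w : seq (int * seq int)) (e : seq nat) : int :=
  foldr (fun q a => q.1 * mon3_val e q.2 + a) 0 w.

(* The points lie on the line x + y + z = 0, and the weights are chosen so that the two
   forms annihilate x^4, y^4 and z^4. *)
Definition weights1 : seq (int * seq int) :=
  [:: (7, [:: 0; 1; -1]); (- 8, [:: 1; 0; -1]); (- 8, [:: 1; -1; 0]); (1, [:: -2; 1; 1])].
Definition weights2 : seq (int * seq int) :=
  [:: (- 8, [:: 0; 1; -1]); (7, [:: 1; 0; -1]); (- 8, [:: 1; -1; 0]); (1, [:: 1; -2; 1])].

(** The 2 by 2 determinant of the images of two monomials under the two functionals; it vanishes iff
    these images are linearly dependent. *)
Definition line_det (e e' : seq nat) : int :=
  line_form weights1 e * line_form weights2 e' - line_form weights1 e' * line_form weights2 e.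

Lemma mon3_degree4 (m : 'X_{1..3}) :
  mdeg m = 4 -> m \in [seq mon3 e | e <- pure4 ++ mixed4].
Proof.
rewrite mdegE !big_ord_recl big_ord0 => dm.
have -> : m = mon3 [:: m ord0; m (lift ord0 ord0); m (lift ord0 (lift ord0 ord0))].
  apply/mnmP => -[[|[|[|//]]] lt_i]; rewrite mnmE /=; congr (m _); exact: val_inj.
apply: map_f; move: (m _) (m _) (m _) dm => a b c dm.
have -> : c = (4 - a - b)%N by lia.
have {dm} : (a + b <= 4)%N by lia.
by case: a => [|[|[|[|[|a]]]]]; case: b => [|[|[|[|[|b]]]]].
Qed.

(** * Pairs with nonzero determinant: x + y + z acts injectively *)

Section GeneralPair.
Variables (K : numFieldType).

Lemma meval_mon3 (e : seq nat) (p : seq int) :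
  'X_[mon3 e].@[fun i : 'I_3 => (p`_i)%:~R] = (mon3_val e p)%:~R :> K.
Proof.
by rewrite mevalX !big_ord_recl big_ord0 mulr1 !mnmE /= /mon3_val !rmorphM !rmorphXn /= mulrA.
Qed.

Lemma succeeds_WLP3 (I : idealr {mpoly K[3]}) (s : seq 'X_{1..3}) (e e' : seq nat) :
    uniq s -> {in s, forall m, mdeg m = 4} -> I =i monomial_ideal s ->
    perm_eq s [seq mon3 i | i <- pure4 ++ [:: e; e']] -> line_det e e' != 0 ->
  ~ fails_WLP I 3.
Proof.
move=> s_uniq s4 Is s_perm det_neq0.
have s5 : size s = 5 by rewrite (perm_size s_perm).
rewrite (fails_WLP_kernel s_uniq s5 s4 Is).
pose L : {mpoly K[3]} := \sum_i 'X_i.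
have L1 : L \is 1.-homog.
  by apply: rpred_sum => i _; rewrite dhomogX; apply/eqP/mdeg1.
move=> /(_ L L1)[f [f3 f_neq0]]; rewrite Is => LfI.
have := homog_sum_monomials s_uniq s4 (dhomogM L1 f3) LfI.
rewrite (perm_big _ s_perm) big_map /=.
set c := fun e => (L * f)@_(mon3 e).
move=> Lf_eq; pose E := pure4 ++ [:: e; e'].
(* Since [L * f] vanishes at every point of the line, each weighted sum of evaluations at such
   points gives a linear relation among the coefficients [c]. *)
have relation w : all (fun q => q.2`_0 + q.2`_1 + q.2`_2 == 0) w ->
    \sum_(x <- E) c x * (line_form w x)%:~R = 0.
  elim: w => [|[a p] w IHw] /=; first by rewrite big1 // => x _; rewrite mulr0.
  move=> /andP[/eqP p0 /IHw{}IHw].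
  under eq_bigr do rewrite rmorphD rmorphM mulrDr mulrCA.
  rewrite big_split /= IHw addr0 -mulr_sumr.
  have Lp : L.@[fun i : 'I_3 => (p`_i)%:~R] = 0.
    rewrite raddf_sum !big_ord_recl big_ord0 /= !mevalXU /= addr0 -!rmorphD addrA /=.
    by rewrite [X in X%:~R](_ : _ = 0).
  have := congr1 (meval (fun i : 'I_3 => (p`_i)%:~R)) Lf_eq.
  rewrite mevalM Lp mul0r raddf_sum => p_rel.
  apply/eqP; rewrite mulf_eq0; apply/orP; right.
  by rewrite [eqbRHS]p_rel; apply/eqP/eq_bigr => x _; rewrite /= mevalZ meval_mon3.
have relation2 w : all (fun q => q.2`_0 + q.2`_1 + q.2`_2 == 0) w ->
    all (fun x => line_form w x == 0) pure4 ->
    c e * (line_form w e)%:~R + c e' * (line_form w e')%:~R = 0.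
  move=> /relation + /allP w0; rewrite big_cat big_seq big1 => [|x /w0/eqP->].
    by rewrite !big_cons big_nil /= add0r addr0.
  by rewrite mulr0.
have rel1 : c e * (line_form weights1 e)%:~R + c e' * (line_form weights1 e')%:~R = 0.
  by apply: relation2; vm_compute.
have rel2 : c e * (line_form weights2 e)%:~R + c e' * (line_form weights2 e')%:~R = 0.
  by apply: relation2; vm_compute.
have det_neq0' : (line_det e e')%:~R != 0 :> K by rewrite intr_eq0.
have ce : c e = 0.
  apply/eqP; rewrite -(mulIr_eq0 _ (mulIf det_neq0')); apply/eqP.
  (* Cramer's rule for the two relations in [c e] and [c e']. *)
  have -> : c e * (line_det e e')%:~R =
      (c e * (line_form weights1 e)%:~R + c e' * (line_form weights1 e')%:~R) * (line_form weights2 e')%:~R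
      - (c e * (line_form weights2 e)%:~R + c e' * (line_form weights2 e')%:~R) * (line_form weights1 e')%:~R.
    by rewrite /line_det; ring.
  by rewrite rel1 rel2 !mul0r subr0.
have ce' : c e' = 0.
  apply/eqP; rewrite -(mulIr_eq0 _ (mulIf det_neq0')); apply/eqP.
  have -> : c e' * (line_det e e')%:~R =
      (c e * (line_form weights2 e)%:~R + c e' * (line_form weights2 e')%:~R) * (line_form weights1 e)%:~R
      - (c e * (line_form weights1 e)%:~R + c e' * (line_form weights1 e')%:~R) * (line_form weights2 e)%:~R.
    by rewrite /line_det; ring.
  by rewrite rel1 rel2 !mul0r subr0.
(* With the mixed coefficients gone, evaluation at a point such as (0, 1, -1) gives the sum of two
   pure coefficients. A signed sum of three such evaluations is twice a single coefficient, whence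
   the factor 2. *)
have pure_rel (w : seq (int * seq int)) (x : seq nat) :
    all (fun q => q.2`_0 + q.2`_1 + q.2`_2 == 0) w ->
    all (fun y => line_form w y == 2 * (y == x)%:Z) pure4 -> x \in pure4 -> c x = 0.
  move=> /relation + /allP wx x_in.
  have -> : \sum_(y <- E) c y * (line_form w y)%:~R = c x * 2%:R.
    have tail0 : \sum_(y <- [:: e; e']) c y * (line_form w y)%:~R = 0.
      by rewrite !big_cons big_nil ce ce' !mul0r !addr0.
    rewrite big_cat tail0 /= addr0 (bigD1_seq x) //= (eqP (wx _ x_in)) eqxx mulr1.
    rewrite big_seq_cond big1 ?addr0 // => y /andP[/wx/eqP-> /negPf->].
    by rewrite !mulr0.
  by move=> /eqP; rewrite mulf_eq0 pnatr_eq0 orbF => /eqP.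
have c1 : c [:: 4; 0; 0] = 0.
  by apply: (pure_rel [:: (-1, [:: 0; 1; -1]); (1, [:: 1; 0; -1]); (1, [:: 1; -1; 0])]).
have c2 : c [:: 0; 4; 0] = 0.
  by apply: (pure_rel [:: (1, [:: 0; 1; -1]); (-1, [:: 1; 0; -1]); (1, [:: 1; -1; 0])]).
have c3 : c [:: 0; 0; 4] = 0.
  by apply: (pure_rel [:: (1, [:: 0; 1; -1]); (1, [:: 1; 0; -1]); (-1, [:: 1; -1; 0])]).
(* Now [L * f = 0] with [f] nonzero, so [L = 0]; but its first coefficient is 1. *)
move: Lf_eq; rewrite !big_cons big_nil -!/(c _) c1 c2 c3 ce ce' !scale0r !addr0 => /eqP.
rewrite mulf_eq0 (negPf f_neq0) orbF => /eqP/(congr1 (mcoeff U_(ord0))).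
rewrite mcoeff0 raddf_sum (bigD1 ord0) //= mcoeffXU eqxx big1 => [/eqP|i /negPf i0].
  by rewrite addr0 oner_eq0.
by rewrite mcoeffXU i0.
Qed.
End GeneralPair.

(** * Pairs with vanishing determinant *)

Definition exps1 : seq (seq nat) := pure4 ++ [:: [:: 3; 0; 1]; [:: 3; 1; 0]].
Definition exps2 : seq (seq nat) := pure4 ++ [:: [:: 2; 2; 0]; [:: 1; 1; 2]].

Definition swap_exp (i j : nat) (e : seq nat) : seq nat :=
  mkseq (fun k => nth 0 e (if k == i then j else if k == j then i else k)) 3.

Lemma mon3_swap (i j : 'I_3) (e : seq nat) :
  mon3 (swap_exp i j e) = mon3 e # tperm i j.
Proof.
apply/mnmP => k; rewrite !mnmE nth_mkseq // permE /=.
by rewrite -!val_eqE /=; do 2 case: ifP => //.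
Qed.

(** A finite check over all pairs of mixed monomials. Each exceptional set of exponents is fixed by
    one transposition, so its three images under the symmetric group are reached by the identity
    (the case [i = j]) and the other two transpositions. *)
Lemma line_det_eq0 (e e' : seq nat) :
    e \in mixed4 -> e' \in mixed4 -> e != e' -> line_det e e' = 0 ->
  exists i j : 'I_3, exists2 g, g \in [:: exps1; exps2] &
    perm_eq (pure4 ++ [:: e; e']) [seq swap_exp i j x | x <- g].
Proof.
move=> e_in e'_in e_neq /eqP det0.
have /allP/(_ e e_in)/allP/(_ e' e'_in)/implyP/(_ det0) :
  all (fun e => all (fun e' => (line_det e e' == 0) ==> ((e == e') ||
    has (fun i => has (fun j => has (fun g =>
      perm_eq (pure4 ++ [:: e; e']) [seq swap_exp i j x | x <- g])
    [:: exps1; exps2]) (iota 0 3)) (iota 0 3))) mixed4) mixed4 by vm_compute.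
rewrite (negPf e_neq) => /hasP[i i_lt /hasP[j j_lt /hasP[g g_in perm_g]]].
rewrite !mem_iota in i_lt j_lt.
by exists (Ordinal i_lt), (Ordinal j_lt), g.
Qed.

(** * Cubics killed by a linear form modulo the exceptional ideals *)

Section Kernels.
Variable K : idomainType.
Implicit Types L f : {mpoly K[3]}.

Lemma linear_formE (n : nat) (R : nzRingType) (L : {mpoly R[n]}) :
  L \is 1.-homog -> L = \sum_i L@_U_(i) *: 'X_i.
Proof.
move=> L1; apply/mpolyP => m; rewrite raddf_sum /=.
have [|m1] := boolP (mdeg m == 1%N).
  move=> /mdeg1P[j /eqP->]; rewrite (bigD1 j) //= mcoeffZ mcoeffXU eqxx mulr1.
  by rewrite big1 ?addr0 // => i /negPf ij; rewrite mcoeffZ mcoeffXU ij mulr0.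
rewrite (dhomog_nemf_coeff L1 m1) big1 // => i _; rewrite mcoeffZ mcoeffX.
by case: (U_(i)%MM =P m) m1 => [<-|]; rewrite ?mdeg1 ?mulr0.
Qed.

Lemma kernel_exps1 L : L \is 1.-homog ->
  exists f, [/\ f \is 3.-homog, f != 0 & L * f \in monomial_ideal (map mon3 exps1)].
Proof.
move=> /dhomogP L1; exists 'X_[mon3 [:: 3; 0; 0]]; split.
- have deg3 : mdeg (mon3 [:: 3; 0; 0]) = 3 by rewrite mdegE !big_ord_recl big_ord0 !mnmE.
  by rewrite dhomogX; apply/eqP.
- apply/eqP => /(congr1 (mcoeff (mon3 [:: 3; 0; 0]))) /eqP.
  by rewrite mcoeffX eqxx mcoeff0 oner_eq0.
(* The cubic is x^3: multiplying it by a variable gives x^4, x^3 y or x^3 z, all generators. *)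
apply/monomial_idealP => m; rewrite (perm_mem (msuppMX _ _)) => /mapP[m' /L1 m'1 ->].
have /mdeg1P[i /eqP->] : mdeg m' == 1%N by exact/eqP.
have [e e_in ->] : exists2 e, e \in exps1 & (mon3 [:: 3; 0; 0]%N + U_(i))%MM = mon3 e.
  case: i => [[|[|[|//]]] lt_i]; [exists [:: 4; 0; 0] | exists [:: 3; 1; 0]
    | exists [:: 3; 0; 1]] => //; apply/mnmP => -[[|[|[|//]]] lt_j];
    by rewrite !mnmE.
by apply/hasP; exists (mon3 e); [exact: map_f|exact: lepm_refl].
Qed.

(* (ax + by + cz)(ax + by - cz)((ax - by)^2 + c^2 z^2)
   = (a^2 x^2 - b^2 y^2)^2 + 4 a b c^2 x y z^2 - c^4 z^4. *)
Lemma kernel_exps2 L : L \is 1.-homog ->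
  exists f, [/\ f \is 3.-homog, f != 0 & L * f \in monomial_ideal (map mon3 exps2)].
Proof.
(* The cubic built from the factorization is zero when [L = 0], where any nonzero cubic serves. *)
move=> L1; have [L0|L_neq0] := eqVneq L 0.
  have [f [f3 f0 _]] := kernel_exps1 L1; exists f; split=> //.
  by rewrite L0 mul0r; exact: ideal_gen0.
set x : {mpoly K[3]} := 'X_ord0.
set y : {mpoly K[3]} := 'X_(lift ord0 ord0).
set z : {mpoly K[3]} := 'X_(lift ord0 (lift ord0 ord0)).
set a := L@_U_(ord0); set b := L@_U_(lift ord0 ord0).
set c := L@_U_(lift ord0 (lift ord0 ord0)).
have LE : L = a *: x + b *: y + c *: z.
  by rewrite {1}(linear_formE L1) !big_ord_recl big_ord0 addr0 addrA.
have X1 i : ('X_i : {mpoly K[3]}) \is 1.-homog by rewrite dhomogX; apply/eqP/mdeg1.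
pose f := (a *: x + b *: y - c *: z) * ((a *: x - b *: y) ^+ 2 + c ^+ 2 *: z ^+ 2).
have f_eval (u v w : K) : f.@[fun i : 'I_3 => nth 0 [:: u; v; w] i] =
    (a * u + b * v - c * w) * ((a * u - b * v) ^+ 2 + c ^+ 2 * w ^+ 2).
  by rewrite !(mevalM, mevalB, mevalD, mevalZ, rmorphXn) /= !mevalXU.
exists f; split.
- have deg1 (u v w : K) : u *: x + v *: y + w *: z \is 1.-homog.
    by rewrite !rpredD ?rpredZ ?X1.
  apply: (@dhomogM _ _ mdeg 1 _ 2); first by rewrite -scaleNr.
  rewrite rpredD //; last by rewrite rpredZ ?(dhomogMn 2 (X1 _)).
  by apply: (@dhomogMn _ _ mdeg 1 _ 2); rewrite rpredB ?rpredZ ?X1.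
(* At the three coordinate points [f] takes the values a^3, b^3 and -c^3, so [f = 0] would force
   [L = 0]. *)
- apply: contraNneq L_neq0 => f0; rewrite f0 in f_eval.
  have a0 : a = 0.
    suff /eqP : a ^+ 3 = 0 by rewrite expf_eq0 => /eqP.
    rewrite -[RHS](meval0 (fun i : 'I_3 => nth (0 : K) [:: 1; 0; 0] i)) f_eval; ring.
  have b0 : b = 0.
    suff /eqP : b ^+ 3 = 0 by rewrite expf_eq0 => /eqP.
    rewrite -[RHS](meval0 (fun i : 'I_3 => nth (0 : K) [:: 0; 1; 0] i)) f_eval; ring.
  have c0 : c = 0.
    suff /eqP : - c ^+ 3 = 0 by rewrite oppr_eq0 expf_eq0 => /eqP.
    rewrite -[RHS](meval0 (fun i : 'I_3 => nth (0 : K) [:: 0; 0; 1] i)) f_eval; ring.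
  by rewrite LE a0 b0 c0 !scale0r !addr0.
have -> : L * f = (a ^+ 4)%:MP * x ^+ 4 + (b ^+ 4)%:MP * y ^+ 4
    + (- c ^+ 4)%:MP * z ^+ 4 + (- 2%:R * a ^+ 2 * b ^+ 2)%:MP * (x ^+ 2 * y ^+ 2)
    + (4%:R * a * b * c ^+ 2)%:MP * (x * y * z ^+ 2).
  rewrite LE /f -!mul_mpolyC; move: (x) (y) (z) => X Y Z.
  rewrite !(rmorphXn, rmorphM, rmorphN, rmorph_nat) /=.
  move: (a%:MP_[3]) (b%:MP_[3]) (c%:MP_[3]) => A B C; ring.
have mem_mon e : e \in exps2 -> 'X_[mon3 e] \in [seq 'X_[m] : {mpoly K[3]} | m <- map mon3 exps2].
  by move=> e_in; rewrite map_f // map_f.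
have XE (i j k : nat) : x ^+ i * y ^+ j * z ^+ k = 'X_[mon3 [:: i; j; k]].
  by rewrite [RHS]mpolyXE_id !big_ord_recl big_ord0 mulr1 !mnmE mulrA.
do 4?apply: ideal_genD; apply: ideal_genM; apply: mem_ideal_gen.
- by have := XE 4 0 0; rewrite !expr0 !mulr1 => ->; exact: mem_mon.
- by have := XE 0 4 0; rewrite !expr0 mulr1 mul1r => ->; exact: mem_mon.
- by have := XE 0 0 4; rewrite !expr0 !mul1r => ->; exact: mem_mon.
- by have := XE 2 2 0; rewrite !expr0 mulr1 => ->; exact: mem_mon.
- by have := XE 1 1 2; rewrite !expr1 => ->; exact: mem_mon.
Qed.
End Kernels.

(** * Artinian quotients and powers of the variables *)

Lemma vspace_of_submod (K : fieldType) (V : vectType K) (P : V -> Prop) :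
    P 0 -> (forall a u v, P u -> P v -> P (a *: u + v)) ->
  exists U : {vspace V}, forall v, v \in U <-> P v.
Proof.
move=> P0 PD.
(* A subspace inside [P] of maximal dimension contains every vector [v] of [P], since otherwise
   adding the line of [v] would increase the dimension. *)
pose Q k := `[< exists2 U : {vspace V}, (forall v, v \in U -> P v) & \dim U = k >].
have Q0 : exists k, Q k.
  by exists 0; apply/asboolP; exists 0%VS; rewrite ?dimv0 // => v; rewrite memv0 => /eqP->.
have Qle k : Q k -> (k <= \dim {:V})%N by move=> /asboolP[U _ <-]; exact/dimvS/subvf.
case: (ex_maxnP Q0 Qle) => _ /asboolP[U UP <-] Umax; exists U => v; split; first exact: UP.
move=> Pv; have : (\dim (U + <[v]>) <= \dim U)%N.
  apply/Umax/asboolP; exists (U + <[v]>)%VS => // _ /memv_addP[u uU [_ /vlineP[a ->] ->]].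
  by rewrite addrC; apply: PD => //; exact: UP.
move=> le_dim; have /eqP-> : U == (U + <[v]>)%VS by rewrite eqEdim addvSl.
by apply: (subvP (addvSr _ _)); exact: memv_line.
Qed.

(** The finitely many monomials with all exponents below [e] span the quotient. Ideals pull back
    along this spanning map to subspaces, and a descending chain of subspaces is constant once its
    dimension is minimal. *)
Lemma artinian_of_powers (n e : nat) (K : fieldType) (I : idealr {mpoly K[n]}) :
  (forall i : 'I_n, 'X_i ^+ e \in I) -> artinian_ideal I.
Proof.
move=> powI J Jsub Jdec.
pose T : finType := {ffun 'I_n -> 'I_e}.
pose mon (t : T) : 'X_{1..n} := [multinom t i : nat | i < n].
pose V : vectType K := {ffun T -> K^o}.
pose reduced (v : V) : {mpoly K[n]} := \sum_t v t *: 'X_[mon t].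
have reducedD a v w : reduced (a *: v + w) = a%:MP * reduced v + reduced w.
  rewrite mul_mpolyC scaler_sumr -big_split; apply: eq_bigr => t _.
  by rewrite !ffunE scalerDl scalerA.
have reduced_surj f : exists v, \pi_{ideal_quot I} (reduced v) = \pi_{ideal_quot I} f.
  elim/mpolyind: f => [|c m p _ _ [v IHv]].
    by exists 0; rewrite /reduced big1 // => t _; rewrite ffunE scale0r.
  (* A monomial with some exponent at least [e] is zero in the quotient; any other is indexed by
     [T]. *)
  have [lt_m|/existsNP[i /negP]] := pselect (forall i, (m i < e)%N); last first.
  - rewrite -leqNgt => le_m; exists v; rewrite IHv rmorphD /=.
    suff /eqP-> : \pi_{ideal_quot I} (c *: 'X_[m]) == 0 by rewrite add0r.
    rewrite pi_ideal_eq0 -mul_mpolyC; apply: idealMr.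
    have le_im : (U_(i) *+ e <= m)%MM.
      by apply/mnm_lepP => j; rewrite mulmnE mnm1E; case: eqP => [<-|]; rewrite ?mul1n.
    by rewrite -(submK le_im) mpolyXD; apply: idealMr; rewrite -mpolyXn.
  pose t : T := [ffun i => Ordinal (lt_m i)].
  exists (c *: [ffun t' => (t' == t)%:R] + v).
  have reduced_t : reduced [ffun t' => (t' == t)%:R] = 'X_[m].
    rewrite /reduced (bigD1 t) //= !ffunE eqxx scale1r big1 => [|t' /negPf tt'].
      by rewrite addr0; congr 'X_[_]; apply/mnmP => i; rewrite mnmE ffunE.
    by rewrite ffunE tt' scale0r.
  by rewrite reducedD rmorphD /= IHv -rmorphD /= reduced_t mul_mpolyC.
have /choice[U UJ] k : exists U : {vspace V}, forall v,
    v \in U <-> \pi_{ideal_quot I} (reduced v) \in J k.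
  have [J0 JD] := Jsub k.
  apply: (vspace_of_submod (P := fun v => \pi_{ideal_quot I} (reduced v) \in J k)).
    by rewrite /reduced big1 ?rmorph0 // => t _; rewrite ffunE scale0r.
  by move=> a u v uJ vJ; rewrite reducedD rmorphD rmorphM; exact: (JD).
have subU k l : (k <= l)%N -> (U l <= U k)%VS.
  move=> /subnK<-; elim: (l - k)%N => [|j IHj]; first by rewrite add0n.
  apply: subv_trans IHj; apply/subvP => v /UJ vJ; apply/UJ; exact: Jdec.
pose Q d := `[< exists k, \dim (U k) = d >].
have Q0 : exists d, Q d by exists (\dim (U 0)); apply/asboolP; exists 0.
case: (ex_minnP Q0) => _ /asboolP[N <-] Nmin; exists N => k le_Nk a.
have UkN : U k = U N.
  by apply/eqP; rewrite eqEdim subU //=; apply/Nmin/asboolP; exists k.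
have [v va] := reduced_surj (generic_quotient.repr a); rewrite reprK in va.
by rewrite -va; apply/idP/idP => /UJ vJ; apply/UJ; rewrite ?UkN // -UkN.
Qed.

(** The chain of ideals generated by the powers of [X] stabilizes, so X_i^N - X_i^(N+1) b lies in
    [I] for some [N] and [b]. Its coefficient at X_i^N is 1, so a generator divides X_i^N and is a
    power of X_i, of degree [d]. *)
Lemma artinian_pure_power (n d : nat) (K : comNzRingType) (I : idealr {mpoly K[n]})
    (s : seq 'X_{1..n}) (i : 'I_n) :
    {in s, forall m, mdeg m = d} -> I =i monomial_ideal s -> artinian_ideal I ->
  (U_(i) *+ d)%MM \in s.
Proof.
move=> sd Is artI; set X := \pi_{ideal_quot I} 'X_i.
pose J k : {pred {ideal_quot I}} := fun a => `[< exists b, a = X ^+ k * b >].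
have [N NJ] : exists N, forall k, (N <= k)%N -> J k =i J N.
  apply: artI => k => [|a /asboolP[b ->]]; last first.
    by apply/asboolP; exists (X * b); rewrite mulrA -exprSr.
  split; first by apply/asboolP; exists 0; rewrite mulr0.
  move=> a _ _ /asboolP[u ->] /asboolP[v ->]; apply/asboolP; exists (a * u + v).
  by rewrite mulrDr mulrCA.
have : X ^+ N \in J N.+1 by rewrite NJ //; apply/asboolP; exists 1; rewrite mulr1.
move=> /asboolP[b] /eqP; rewrite -[b]reprK -!rmorphXn -rmorphM -subr_eq0 -rmorphB.
rewrite pi_ideal_eq0 Is => /monomial_idealP/(_ (U_(i) *+ N)%MM).
rewrite mcoeff_msupp mcoeffB !mpolyXn mcoeffX eqxx.
(* Every monomial of a multiple of X_i^(N+1) has degree above [N]. *)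
rewrite [X in 1%:R - X](_ : _ = 0) ?subr0 ?oner_eq0; last first.
  apply/eqP; rewrite mcoeff_eq0 mulrC (perm_mem (msuppMX _ _)); apply/mapP => -[m' _].
  move=> /(congr1 mdeg); rewrite mdegD !mdegMn mdeg1 !mul1n; lia.
move=> /(_ isT)/hasP[m m_s /mnm_lepP le_m].
suff <- : m = (U_(i) *+ d)%MM by [].
have m0 j : i != j -> m j = 0%N.
  by move=> /negPf ij; have := le_m j; rewrite mulmnE mnm1E ij leqn0 => /eqP.
apply/mnmP => j; rewrite mulmnE mnm1E -(sd m m_s).
have [<-|/m0-> //] := eqVneq i j.
by rewrite mul1n mdegE (bigD1 i) //= big1 ?addn0 // => k; rewrite eq_sym => /m0.
Qed.

(** * Transport along permutations of the variables *)

Section Transport.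
Variables (n : nat) (K : comNzRingType).

Lemma msym_homog (d : nat) (sg : 'S_n) (f : {mpoly K[n]}) :
  (msym sg f \is d.-homog) = (f \is d.-homog).
Proof.
apply/dhomogP/dhomogP => fd m.
  rewrite -[m](mpermK sg) mcoeff_msupp -mcoeff_sym -mcoeff_msupp => /fd <-.
  exact: mdeg_mperm.
by rewrite mcoeff_msupp mcoeff_sym -mcoeff_msupp => /fd <-; rewrite /= mdeg_mperm.
Qed.

(** The image of [J] under [msym sg] is its preimage under the inverse permutation, which is why
    both directions invert [sg]. *)
Lemma eq_up_to_permP (I J : idealr {mpoly K[n]}) (s : seq 'X_{1..n}) :
    J =i monomial_ideal s ->
  eq_up_to_perm I J <->
  exists sg : 'S_n, I =i monomial_ideal [seq m#sg | m : 'X_{1..n} <- s].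
Proof.
move=> Js; have invK (sg : 'S_n) : cancel (msym (R := K) sg^-1) (msym sg).
  by move=> f; rewrite -msymMm mulVg msym1m.
split=> -[sg Isg].
  exists sg^-1%g => f; rewrite -msym_monomial_ideal -Js.
  have IE : (f \in I : Prop) = (msym sg @` [set` J])%classic f by rewrite -Isg.
  apply/idP/idP => [|fJ]; first by rewrite IE => -[g gJ <-]; rewrite -msymMm mulgV msym1m.
  by rewrite IE; exists (msym sg^-1 f); rewrite ?invK.
exists sg^-1%g; apply/seteqP; split=> f /=.
  rewrite Isg -msym_monomial_ideal -Js => fJ; exists (msym sg f) => //.
  by rewrite -msymMm mulgV msym1m.
by move=> [g gJ <-]; rewrite Isg -msym_monomial_ideal invK -Js.
Qed.
End Transport.

(** * The two exceptional ideals as monomial ideals *)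

Lemma mnm1_mon3 (i : 'I_3) : U_(i)%MM = mon3 (mkseq (fun k => (k == i) : nat) 3).
Proof. by apply/mnmP => j; rewrite mnm1E mnmE nth_mkseq // -val_eqE eq_sym. Qed.

Lemma I1_monomial (K : comNzRingType) : @I1 K =i monomial_ideal (map mon3 exps1).
Proof.
move=> f; rewrite /I1 !mpolyXn -!mpolyXD !mnm1_mon3; congr (f \in ideal_gen [:: _; _; _; _; _]);
  by congr 'X_[_]; apply/mnmP => -[[|[|[|//]]] lt_j]; rewrite !(mnmDE, mulmnE, mnmE).
Qed.

Lemma I2_monomial (K : comNzRingType) : @I2 K =i monomial_ideal (map mon3 exps2).
Proof.
move=> f; rewrite /I2 !mpolyXn -!mpolyXD !mnm1_mon3; congr (f \in ideal_gen [:: _; _; _; _; _]);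
  by congr 'X_[_]; apply/mnmP => -[[|[|[|//]]] lt_j]; rewrite !(mnmDE, mulmnE, mnmE).
Qed.

(** [mon3] pads with zeros and truncates, so injectivity is claimed only on the listed triples. *)
Lemma mon3_inj : {in pure4 ++ mixed4 &, injective mon3}.
Proof.
move=> e e' e_in e'_in /mnmP E; apply/eqP.
have [E0 E1 E2] : [/\ nth 0 e 0 = nth 0 e' 0, nth 0 e 1 = nth 0 e' 1 & nth 0 e 2 = nth 0 e' 2]%N.
  by split; [have := E 0 | have := E 1 | have := E 2%:R]; rewrite !mnmE.
have : all (fun e => all (fun e' => (nth 0 e 0 == nth 0 e' 0) ==> (nth 0 e 1 == nth 0 e' 1)
  ==> (nth 0 e 2 == nth 0 e' 2) ==> (e == e'))%N (pure4 ++ mixed4)) (pure4 ++ mixed4).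
  by vm_compute.
by move=> /allP/(_ e e_in)/allP/(_ e' e'_in); rewrite E0 E1 E2 !eqxx.
Qed.

(** * The classification *)

Section Classification.
Variable K : numFieldType.
Implicit Type I : idealr {mpoly K[3]}.

Lemma exceptional_fails (I J : idealr {mpoly K[3]}) (g : seq (seq nat)) :
    g \in [:: exps1; exps2] -> J =i monomial_ideal (map mon3 g) ->
    eq_up_to_perm I J ->
  generated_by_monomials I 5 4 /\ artinian_ideal I /\ fails_WLP I 3.
Proof.
move=> g_in Jg /(eq_up_to_permP _ Jg)[sg Isg].
set s := [seq m#sg | m : 'X_{1..3} <- map mon3 g] in Isg.
have g_sub : {subset g <= pure4 ++ mixed4}.
  by apply/allP; move: g_in; rewrite !inE => /orP[] /eqP->; vm_compute.
have s_uniq : uniq s.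
  rewrite (map_inj_uniq (@mperm_inj _ sg)) map_inj_in_uniq.
    by move: g_in; rewrite !inE => /orP[] /eqP->; vm_compute.
  by move=> e e' /g_sub e_in /g_sub e'_in; exact: mon3_inj.
have s5 : size s = 5 by move: g_in; rewrite !size_map !inE => /orP[] /eqP->.
have s4 : {in s, forall m, mdeg m = 4}.
  move=> _ /mapP[_ /mapP[e /g_sub e_in ->] ->]; rewrite mdeg_mperm mdegE.
  rewrite !big_ord_recl big_ord0 !mnmE; apply/eqP; move: e e_in; apply/allP.
  by vm_compute.
split; first by exists s.
split.
  apply: (@artinian_of_powers _ 4) => i; rewrite Isg mpolyXn; apply: mem_ideal_gen.
  (* The exponent [m#sg] at [j] is that of [m] at [sg j], so the fourth power of the variable [sg i]
     becomes that of [i]. *)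
  apply/map_f/mapP; exists (U_(sg i) *+ 4)%MM.
    pose e := nth [::] pure4 (sg i).
    apply/mapP; exists e.
      by move: g_in; rewrite /e !inE => /orP[] /eqP->; case: (sg i) => -[|[|[|//]]].
    rewrite /e; case: (sg i) => -[|[|[|//]]] lt_i; apply/mnmP => -[[|[|[|//]]] lt_j];
      by rewrite mulmnE mnm1E mnmE.
  by apply/mnmP => j; rewrite mnmE !mulmnE !mnm1E (inj_eq perm_inj).
apply/(fails_WLP_kernel s_uniq s5 s4 Isg) => L L1.
have sgL1 : msym sg L \is 1.-homog by rewrite msym_homog.
(* A cubic killed by [msym sg L] modulo [J] is carried back by the inverse permutation to one killed
   by [L] modulo [I]. *)
have [f [f3 f0 LfJ]] : exists f, [/\ f \is 3.-homog, f != 0 &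
    msym sg L * f \in monomial_ideal (map mon3 g)].
  move: g_in; rewrite !inE => /orP[] /eqP->;
    [exact: kernel_exps1 | exact: kernel_exps2].
have fE : msym sg (msym sg^-1 f) = f by rewrite -msymMm mulVg msym1m.
exists (msym sg^-1 f); split; first by rewrite msym_homog.
  by apply: contraNneq f0 => f0; rewrite -fE f0 msym0.
by rewrite Isg -msym_monomial_ideal msymM fE.
Qed.

(** Artinianity puts the three pure fourth powers among the five generators. By [succeeds_WLP3] the
    determinant of the two remaining mixed monomials is zero, and [line_det_eq0] identifies the
    pair. *)
Lemma failing_exceptional I :
    generated_by_monomials I 5 4 -> artinian_ideal I -> fails_WLP I 3 ->
  eq_up_to_perm I (@I1 K) \/ eq_up_to_perm I (@I2 K).
Proof.
move=> [s [s_uniq s5 s4 Is]] artI failI.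
have pure_s : {subset map mon3 pure4 <= s}.
  have in_s (i : 'I_3) := artinian_pure_power i s4 Is artI.
  have pureE (i : 'I_3) : mon3 (nth [::] pure4 i) = (U_(i) *+ 4)%MM.
    case: i => -[|[|[|//]]] lt_i; apply/mnmP => -[[|[|[|//]]] lt_j];
      by rewrite mulmnE mnm1E mnmE.
  move=> _ /mapP[e e_in ->].
  have lt_e : (index e pure4 < 3)%N by move: e_in; rewrite -index_mem.
  by rewrite -(nth_index [::] e_in) -[index e pure4]/(val (Ordinal lt_e)) pureE.
have pure_uniq : uniq (map mon3 pure4).
  rewrite map_inj_in_uniq // => e e' e_in e'_in; apply: mon3_inj;
  by rewrite mem_cat ?e_in ?e'_in.
pose t := filter [predC map mon3 pure4] s.
have s_perm : perm_eq s (map mon3 pure4 ++ t).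
  rewrite -(perm_filterC (mem (map mon3 pure4)) s) perm_sym perm_cat2r.
  rewrite uniq_perm ?filter_uniq // => m; rewrite mem_filter.
  by apply/esym/andb_idr; exact: pure_s.
have t_mixed m : m \in t -> exists2 e, e \in mixed4 & m = mon3 e.
  rewrite mem_filter => /andP[m_pure /s4/mon3_degree4/mapP[e]].
  rewrite mem_cat => /orP[e_in def_m|]; last by exists e.
  by case/negP: m_pure; rewrite def_m; exact: map_f.
have : size t = 2 by have := perm_size s_perm; rewrite s5 size_cat => -[].
have : uniq t by rewrite filter_uniq.
case def_t: t t_mixed s_perm => [|m [|m' []]] // t_mixed s_perm.
have [e e_in def_m] := t_mixed m (mem_head _ _).
have [e' e'_in def_m'] : exists2 e, e \in mixed4 & m' = mon3 e.
  by apply: t_mixed; rewrite !inE eqxx orbT.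
rewrite /= inE andbT => mm' _.
have s_perm' : perm_eq s (map mon3 (pure4 ++ [:: e; e'])).
  by rewrite map_cat /= -def_m -def_m'.
have e_neq : e != e' by apply: contraNneq mm' => ee'; rewrite def_m def_m' ee'.
have det0 : line_det e e' = 0.
  apply/eqP; apply/negPn/negP => det_neq0.
  exact: (succeeds_WLP3 s_uniq s4 Is s_perm' det_neq0).
have [i [j [g g_in perm_g]]] := line_det_eq0 e_in e'_in e_neq det0.
have I_perm (J : idealr {mpoly K[3]}) :
    J =i monomial_ideal (map mon3 g) -> eq_up_to_perm I J.
  move=> Jg; apply/(eq_up_to_permP _ Jg); exists (tperm i j) => f; rewrite Is.
  apply: eq_monomial_ideal => m''; rewrite (perm_mem s_perm') (perm_mem (perm_map _ perm_g)).
  by rewrite -!map_comp; congr (_ \in _); apply: eq_map => x /=; rewrite mon3_swap.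
move: g_in I_perm; rewrite !inE => /orP[] /eqP-> I_perm; [left|right]; apply: I_perm.
  exact: I1_monomial.
exact: I2_monomial.
Qed.
End Classification.

(** The first ideal contains x^3 z. In degree 4 a permuted copy of the second contains only those
    monomials that are its generators, and none of these has an exponent equal to 3. *)
Lemma I1_not_perm_I2 (K : comNzRingType) : ~ eq_up_to_perm (@I1 K) (@I2 K).
Proof.
have deg4 e : e \in pure4 ++ mixed4 -> mdeg (mon3 e) = 4.
  move=> e_in; rewrite mdegE !big_ord_recl big_ord0 !mnmE; apply/eqP.
  by move: e e_in; apply/allP; vm_compute.
case/(eq_up_to_permP _ (@I2_monomial K)) => sg I12.
have : 'X_[mon3 [:: 3; 0; 1]] \in @I1 K.
  by rewrite I1_monomial; apply/mem_ideal_gen/map_f/map_f.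
rewrite I12 => /monomial_idealP/(_ (mon3 [:: 3; 0; 1])); rewrite msuppX mem_head.
move=> /(_ isT)/hasP[_ /mapP[_ /mapP[e e_in ->] ->] le_e].
have e_deg : mdeg (mon3 e) = 4.
  by apply: deg4; move: e e_in {le_e}; apply/allP.
have /(congr1 (fun m : 'X_{1..3} => m ord0)) : mon3 e # sg = mon3 [:: 3; 0; 1].
  by apply: mnm_le_mdeg_eq le_e _; rewrite mdeg_mperm e_deg deg4.
rewrite !mnmE /= => e3.
have : all (fun e => all (fun k => nth 0 e k != 3) (iota 0 3))%N exps2 by vm_compute.
move=> /allP/(_ e e_in)/allP/(_ (sg ord0)); rewrite mem_iota add0n ltn_ord e3.
by move=> /(_ isT).
Qed.

Theorem theorem6p1 (R : realType) :
  (forall I : idealr {mpoly R[i][3]},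
     (generated_by_monomials I 5 4 /\ artinian_ideal I /\ fails_WLP I 3)
     <->
     (eq_up_to_perm I (@I1 R[i]) \/ eq_up_to_perm I (@I2 R[i]))) /\
  ~ eq_up_to_perm (@I1 R[i]) (@I2 R[i]).
Proof.
split; last exact: I1_not_perm_I2.
move=> I; split=> [[genI [artI failI]]|].
  exact: failing_exceptional.
case; [apply: exceptional_fails (@I1_monomial _)|apply: exceptional_fails (@I2_monomial _)];
  by rewrite !inE eqxx ?orbT.
Qed.
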